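(* Let $K$ be a field, $R=K[x_1,\ldots,x_d]$, $k,N\in\mathbb{N}$, and let $p=\sum_{\tilde{i}\in s_p(N)}a_{\tilde{i}}\tilde{x}^{\tilde{i}}\in R$ be a homogeneous polynomial of degree $N$, where $s_p(N)$ is a non-empty set of vectors $\tilde{i}\in\mathbb{N}_0^d$ with $i_1+\cdots+i_d=N$ and $\tilde{i}\leq(k-1)\tilde{1}$ componentwise, and $a_{\tilde{i}}\in K\setminus\{0\}$ for each $\tilde{i}\in s_p(N)$. Let $I=((x_1^k,\ldots,x_d^k):p)$ and $\Delta=d(k-1)-N$, and let $P=P(t_1,\ldots,t_d)\in K[t_1,\ldots,t_d]$ be the polynomial defined by $$(t_1\overline{x}_1+\cdots+t_d\overline{x}_d)^{\Delta}=P(t_1,\ldots,t_d)\,\overline{\tilde{x}^{(k-1)\tilde{1}-\tilde{\mu}}}\quad\text{in } K[t_1,\ldots,t_d]\otimes_K (R/I)_{\Delta},$$ where $\tilde{\mu}\in s_p(N)$ is such that $\tilde{x}^{\tilde{\mu}}$ is the largest monomial of $p$ with respect to LEX. Then, up to a non-zero scalar factor in $K$, $$P=\sum_{\tilde{i}\in s_p(N)}\binom{\Delta}{k-1-i_1\ \cdots\ k-1-i_d}\,a_{\tilde{i}}\,\tilde{t}^{(k-1)\tilde{1}-\tilde{i}} .$$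
   Context: Notation: $\tilde{x}^{\tilde{i}}=x_1^{i_1}\cdots x_d^{i_d}$, similarly $\tilde{t}^{\tilde{i}}$; $\tilde{1}=(1,\ldots,1)$; $\overline{f}$ denotes the class of $f$ in $R/I$. The symbol $\binom{\Delta}{m_1\ \cdots\ m_d}$ with $m_1+\cdots+m_d=\Delta$ is the multinomial coefficient $\Delta!/(m_1!\cdots m_d!)$. LEX is the lexicographical order on monomials with $x_1\prec x_2\prec\cdots\prec x_d$: first compare exponents of $x_d$, then in case of equality those of $x_{d-1}$, and so on. The ideal $I$ is homogeneous, and $R/I=\bigoplus_{i=0}^{\Delta}(R/I)_i$ is a graded $K$-algebra in which $(R/I)_{\Delta}$ is one-dimensional over $K$, spanned by the class of $\tilde{x}^{(k-1)\tilde{1}-\tilde{\mu}}$; hence $P$ is well defined. *)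

(* Defs.v *)
From HB Require Import structures.
From mathcomp Require Import all_boot all_order all_algebra.
From mathcomp Require Import finmap.
From mathcomp Require Export mpoly.
From mathcomp Require Import boolp.

Set Implicit Arguments.
Unset Strict Implicit.
Unset Printing Implicit Defensive.

Import GRing.Theory.
Local Open Scope ring_scope.
Local Open Scope quotient_scope.

Definition ideal_gen (R : comNzRingType) (n : nat) (g : 'I_n -> R) : {pred R} :=
  fun f => `[< exists c : 'I_n -> R, f = \sum_(j < n) c j * g j >].

Definition colon (R : comNzRingType) (J : {pred R}) (p : R) : {pred R} :=
  fun f => f * p \in J.

Lemma ideal_genP (R : comNzRingType) (n : nat) (g : 'I_n -> R) (f : R) :
  reflect (exists c : 'I_n -> R, f = \sum_(j < n) c j * g j)
          (f \in ideal_gen g).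
Proof. exact: asboolP. Qed.

Lemma colon_idealr_closed (R : comNzRingType) (n : nat) (g : 'I_n -> R) (p : R) :
  p \notin ideal_gen g -> idealr_closed (colon (ideal_gen g) p).
Proof.
rewrite /colon => gNp; split=> [||b f h].
- rewrite unfold_in mul0r; apply/ideal_genP; exists (fun=> 0).
  by rewrite big1 // => j _; rewrite mul0r.
- by rewrite unfold_in mul1r.
rewrite !unfold_in -/(_ \in _) => /ideal_genP[c fE] /ideal_genP[e hE].
apply/ideal_genP; exists (fun j => b * c j + e j).
rewrite mulrDl -mulrA fE hE mulr_sumr -big_split.
by apply: eq_bigr => j _; rewrite mulrDl mulrA.
Qed.

(* {ideal_quot _} requires a non-trivial quotient, so the ideal (g : p) is
   built from a proof that it is proper, i.e. that p is not in (g). *)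
Definition colon_ideal (R : comNzRingType) (n : nat) (g : 'I_n -> R) (p : R)
  (gNp : p \notin ideal_gen g) : {pred R} := colon (ideal_gen g) p.

HB.instance Definition _ (R : comNzRingType) (n : nat) (g : 'I_n -> R) (p : R)
    (gNp : p \notin ideal_gen g) :=
  isIdealr.Build R (colon_ideal gNp) (colon_idealr_closed gNp).

Definition mpoly_of (K : fieldType) (d : nat) (s : {fset 'X_{1..d}})
  (a : 'X_{1..d} -> K) : {mpoly K[d]} := \sum_(i <- s) a i *: 'X_[i].

Definition power_vars (K : fieldType) (d k : nat) : 'I_d -> {mpoly K[d]} :=
  fun j => 'X_j ^+ k.

Lemma mpoly_of_notin (K : fieldType) (d k : nat) (s : {fset 'X_{1..d}})
    (a : 'X_{1..d} -> K) :
  (0 < k)%N -> s != fset0 ->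
  (forall i, i \in s -> forall j, (i j <= k - 1)%N) ->
  (forall i, i \in s -> a i != 0) ->
  mpoly_of s a \notin ideal_gen (power_vars K (d := d) k).
Proof.
move=> k_gt0 /fset0Pn[m ms] sle a_neq0; apply/negP => /ideal_genP[c /(congr1 (mcoeff m))].
have -> : (mpoly_of s a)@_m = a m.
  rewrite /mpoly_of raddf_sum (big_fsetD1 m) //= mcoeffZ mcoeffX eqxx mulr1.
  rewrite big_seq big1 ?addr0 // => i; rewrite !inE => /andP[iNm _].
  by rewrite mcoeffZ mcoeffX (negPf iNm) mulr0.
rewrite raddf_sum big1 /=; first by move/eqP; rewrite (negPf (a_neq0 _ ms)).
move=> j _; rewrite /power_vars mpolyXn.
apply: memN_msupp_eq0; rewrite (perm_mem (msuppMX _ _)).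
apply/mapP => -[m' _ mE]; have := sle m ms j.
rewrite mE mnmDE mulmnE mnm1E eqxx mul1n.
by rewrite -ltnS subn1 prednK // ltnNge leq_addr.
Qed.

Definition class (R : comNzRingType) (I : idealr R) (f : R) : {ideal_quot I} :=
  \pi_{ideal_quot I} f.

(* K[t_1, ..., t_d] (x)_K A, for A a quotient of K[x_1, ..., x_d], is
   represented by A[t_1, ..., t_d], in which P (x) u is [tensor P u].  For a
   K-subspace V of A, such as a homogeneous component, K[t] (x)_K V embeds in it
   as the polynomials with coefficients in V. *)
Definition tensor (K : fieldType) (d : nat) (I : idealr {mpoly K[d]})
    (P : {mpoly K[d]}) (u : {ideal_quot I}) : {mpoly {ideal_quot I}[d]} :=
  map_mpoly (fun c : K => class I c%:MP) P * u%:MP.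

(* The variable of highest index is compared first: x_1 < ... < x_d.  (The
   library order on 'X_{1..d} is degrevlex.) *)
Definition lex_lt (d : nat) (m1 m2 : 'X_{1..d}) : Prop :=
  exists j : 'I_d, (m1 j < m2 j)%N /\
    forall l : 'I_d, (j < l)%N -> m1 l = m2 l.

(* The exponent (k - 1)1 - i; truncated subtraction, so only for i <= (k - 1)1. *)
Definition codeg (d k : nat) (i : 'X_{1..d}) : 'X_{1..d} :=
  [multinom (k - 1 - i j)%N | j < d].

(* The division is exact when mdeg m = D. *)
Definition multinomial (d D : nat) (m : 'X_{1..d}) : nat :=
  (D`! %/ \prod_(j < d) (m j)`!)%N.

(* Main.v *)
From HB Require Import structures.
Require Import Defs.
From mathcomp Require Import all_boot all_order all_algebra.
From mathcomp Require Import finmap.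
Local Open Scope ring_scope.

Set Implicit Arguments.
Unset Strict Implicit.
Unset Printing Implicit Defensive.

Import GRing.Theory Num.Theory.
Local Open Scope quotient_scope.

(** The coefficient of x^((k-1)1) vanishes on (x_1^k, ..., x_d^k), so the
    linear form f |-> [x^((k-1)1)] (f p) vanishes on I.  Applied to the
    coefficient of t^m in the defining identity of P, it yields
    P_m a_mu = (Delta choose m) a_((k-1)1 - m), by the multinomial theorem. *)

Lemma mderiv_exp (R : comNzRingType) (d : nat) (i : 'I_d) (q : {mpoly R[d]})
    (n : nat) :
  mderiv i (q ^+ n.+1) = (q ^+ n * mderiv i q) *+ n.+1.
Proof.
elim: n => [|n IHn]; first by rewrite expr1 expr0 mul1r.
rewrite exprS mderivM IHn mulrnAr mulrA -exprS [mderiv i q * _]mulrC.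
by rewrite -mulrS.
Qed.

Lemma mderiv_sum_vars (R : comNzRingType) (d : nat) (i : 'I_d) :
  mderiv i (\sum_(j < d) 'X_j : {mpoly R[d]}) = 1.
Proof.
rewrite raddf_sum (bigD1 i) //= mderivX mnm1E eqxx scale1r.
rewrite -[X in (X - _)%MM]add0m addmK mpolyX0 big1 ?addr0 // => j jNi.
by rewrite mderivX mnm1E (negPf jNi) scale0r.
Qed.

(** Multinomial theorem with denominators cleared, so that it makes sense in any characteristic.
    Induction on the degree: differentiation lowers the power by one. *)
Lemma mcoeff_sum_vars_exp_fact (R : comNzRingType) (d n : nat) (m : 'X_{1..d}) :
  mdeg m = n ->
  ((\sum_(j < d) 'X_j : {mpoly R[d]}) ^+ n)@_m * (\prod_(j < d) (m j)`!)%:R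
    = n`!%:R.
Proof.
elim: n m => [|n IHn] m deg_m.
  move/eqP: deg_m; rewrite mdeg_eq0 => /eqP->.
  rewrite expr0 mcoeff1 eqxx mul1r big1 // => j _.
  by rewrite mnm0E.
have [i mi_neq0] : exists i, m i != 0%N.
  apply/existsP; rewrite -negb_forall; apply/negP => /forallP m0.
  suff m_eq0 : m = 0%MM by rewrite m_eq0 mdeg0 in deg_m.
  by apply/mnmP => j; rewrite mnm0E; apply/eqP/m0.
have mE : m = (m - U_(i) + U_(i))%MM by rewrite submK // lep1mP.
set m' := (m - U_(i))%MM in mE.
have deg_m' : mdeg m' = n.
  by apply/succn_inj; rewrite -deg_m mE mdegD mdeg1 addn1.
(* Comparing coefficients at [m'] gives [m i] times the coefficient at [m] on one side, and [n.+1]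
   times the coefficient of the [n]-th power at [m'] on the other. *)
have := congr1 (mcoeff m') (mderiv_exp i (\sum_(j < d) 'X_j : {mpoly R[d]}) n).
rewrite mcoeff_mderiv -mE mderiv_sum_vars mulr1 mcoeffMn => coefE.
have -> : (\prod_(j < d) (m j)`! = (m' i).+1 * \prod_(j < d) (m' j)`!)%N.
  rewrite (bigD1 i) //= [in RHS](bigD1 i) //= mulnA -factS.
  rewrite {1}mE mnmDE mnm1E eqxx addn1; congr (_ * _)%N.
  apply: eq_bigr => j jNi.
  by rewrite mE mnmDE mnm1E eq_sym (negPf jNi) addn0.
rewrite natrM mulrA [_ * (m' i).+1%:R]mulr_natr coefE mulrnAl IHn //.
by rewrite -mulrnA mulnC.
Qed.

(** Over the integers the product of factorials is non-zero and can be cancelled. *)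
Lemma mcoeff_sum_vars_exp_int (d n : nat) (m : 'X_{1..d}) :
  mdeg m = n ->
  ((\sum_(j < d) 'X_j : {mpoly int[d]}) ^+ n)@_m = (multinomial n m)%:R.
Proof.
move=> /(@mcoeff_sum_vars_exp_fact int) coefE.
have prod_gt0 : (0 < \prod_(j < d) (m j)`!)%N.
  by apply: prodn_gt0 => j; rewrite fact_gt0.
rewrite -[LHS](@mulzK _ (\prod_(j < d) (m j)`!)%:R) ?coefE.
  by rewrite !natz divz_nat.
by rewrite pnatr_eq0 -lt0n.
Qed.

(** Transported from [int] along [intr], since the factorials may vanish in [R]; outside degree [n]
    the coefficient is zero by homogeneity. *)
Lemma mcoeff_sum_vars_exp (R : comNzRingType) (d n : nat) (m : 'X_{1..d}) :
  ((\sum_(j < d) 'X_j : {mpoly R[d]}) ^+ n)@_m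
    = (if mdeg m == n then multinomial n m else 0%N)%:R.
Proof.
have -> : (\sum_(j < d) 'X_j : {mpoly R[d]}) ^+ n
    = map_mpoly intr ((\sum_(j < d) 'X_j : {mpoly int[d]}) ^+ n).
  rewrite rmorphXn rmorph_sum /=; congr (_ ^+ n).
  by apply: eq_bigr => j _; rewrite map_mpolyX.
rewrite mcoeff_map_mpoly; case: eqP => [deg_m | /eqP deg_m].
  by rewrite mcoeff_sum_vars_exp_int //= rmorph_nat.
suff exp_homog : (\sum_(j < d) 'X_j : {mpoly int[d]}) ^+ n \is n.-homog.
  by rewrite (dhomog_nemf_coeff exp_homog deg_m).
rewrite -[X in X.-homog]mul1n; apply: dhomogMn.
by apply: rpred_sum => j _; rewrite dhomogX /= mdeg1.
Qed.

(** Substituting [y j *: 'X_j] for ['X_j] is diagonal on monomials; it carries the sum of the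
    variables to a general linear form, and the multinomial theorem with it. *)
Lemma mcoeff_mmap_scale_vars (R : comNzRingType) (d : nat) (y : 'I_d -> R)
    (q : {mpoly R[d]}) (m : 'X_{1..d}) :
  (mmap (@mpolyC d R) (fun j => y j *: 'X_j) q)@_m
    = q@_m * \prod_(j < d) y j ^+ m j.
Proof.
have mmap1E m' :
    mmap1 (fun j => y j *: 'X_j) m' = (\prod_(j < d) y j ^+ m' j) *: 'X_[m'].
  rewrite /mmap1 mpolyXE_id -scaler_prod.
  by apply: eq_bigr => j _; rewrite exprZn.
rewrite /mmap raddf_sum /= [in RHS](mpolyE q) raddf_sum /= mulr_suml.
apply: eq_bigr => m' _.
rewrite mmap1E mcoeffCM !mcoeffZ mcoeffX.
by case: eqP => [->|_]; rewrite ?mulr1 // !mulr0 mul0r.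
Qed.

Lemma mcoeff_linear_form_exp (R : comNzRingType) (d n : nat) (y : 'I_d -> R)
    (m : 'X_{1..d}) :
  ((\sum_(j < d) y j *: 'X_j) ^+ n)@_m
    = (if mdeg m == n then multinomial n m else 0%N)%:R
      * \prod_(j < d) y j ^+ m j.
Proof.
rewrite -mcoeff_sum_vars_exp -mcoeff_mmap_scale_vars rmorphXn rmorph_sum /=.
by congr ((_ ^+ n)@_m); apply: eq_bigr => j _; rewrite mmapX mmap1U.
Qed.

(** Every monomial of a multiple of ['X_j ^+ k] has exponent at least [k] in the variable of index
    [j]. *)
Lemma mcoeff_ideal_gen_power_vars (K : fieldType) (d k : nat)
    (f : {mpoly K[d]}) (m : 'X_{1..d}) :
  f \in ideal_gen (power_vars K (d := d) k) -> (forall j, m j < k)%N ->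
  f@_m = 0.
Proof.
move=> /ideal_genP[c ->] m_lt; rewrite raddf_sum big1 //= => j _.
rewrite /power_vars mpolyXn; apply: memN_msupp_eq0.
rewrite (perm_mem (msuppMX _ _)); apply/mapP => -[m' _ mE].
have := m_lt j.
by rewrite mE mnmDE mulmnE mnm1E eqxx mul1n ltnNge leq_addr.
Qed.

(* [codeg k 0] is the exponent (k - 1)1. *)
Lemma codegK (d k : nat) (i : 'X_{1..d}) :
  (forall j, i j <= k - 1)%N -> (i + codeg k i = codeg k 0)%MM.
Proof.
by move=> i_le; apply/mnmP => j; rewrite mnmDE !mnmE subn0 subnKC.
Qed.

Lemma mdeg_codeg (d k : nat) (i : 'X_{1..d}) :
  (forall j, i j <= k - 1)%N -> mdeg (codeg k i) = (d * (k - 1) - mdeg i)%N.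
Proof.
move=> /codegK/(congr1 (@mdeg d)); rewrite mdegD => degE.
have -> : (d * (k - 1))%N = mdeg (@codeg d k 0).
  rewrite mdegE (eq_bigr (fun=> (k - 1)%N)) => [|j _].
    by rewrite sum_nat_const card_ord.
  by rewrite !mnmE subn0.
by rewrite -degE addKn.
Qed.

Lemma mcoeff_mpoly_of (K : fieldType) (d : nat) (s : {fset 'X_{1..d}})
    (a : 'X_{1..d} -> K) (m : 'X_{1..d}) :
  m \in s -> (mpoly_of s a)@_m = a m.
Proof.
move=> ms; rewrite /mpoly_of raddf_sum (big_fsetD1 m) //= mcoeffZ mcoeffX eqxx.
rewrite mulr1 big_seq big1 ?addr0 // => i; rewrite !inE => /andP[iNm _].
by rewrite mcoeffZ mcoeffX (negPf iNm) mulr0.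
Qed.

(** A term of exponent [i] reaches the top exponent only when multiplied by the complementary
    monomial, of exponent [codeg k i]. *)
Lemma mcoeff_mpoly_ofMX (K : fieldType) (d k : nat) (s : {fset 'X_{1..d}})
    (a : 'X_{1..d} -> K) (m : 'X_{1..d}) :
  (forall i, i \in s -> forall j, (i j <= k - 1)%N) ->
  (mpoly_of s a * 'X_[m])@_(codeg k 0)
    = \sum_(i <- s) a i * (codeg k i == m)%:R.
Proof.
move=> s_le; rewrite /mpoly_of mulr_suml raddf_sum /=.
apply: eq_big_seq => i /s_le/codegK <-.
by rewrite -scalerAl -mpolyXD mcoeffZ mcoeffX eqm_add2l eq_sym.
Qed.

Section Class.
Variables (R : comNzRingType) (I : idealr R).

(** Transfers the ring morphism structure of the projection to [class], so that the [rmorph] lemmas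
    apply to it. *)
Lemma class_is_zmod_morphism : zmod_morphism (class I).
Proof. exact: (rmorphB (\pi_{ideal_quot I})). Qed.

Lemma class_is_monoid_morphism : monoid_morphism (class I).
Proof.
by split; [exact: (rmorph1 (\pi_{ideal_quot I}))
          | exact: (rmorphM (\pi_{ideal_quot I}))].
Qed.

HB.instance Definition _ :=
  GRing.isZmodMorphism.Build R {ideal_quot I} (class I) class_is_zmod_morphism.
HB.instance Definition _ :=
  GRing.isMonoidMorphism.Build R {ideal_quot I} (class I)
    class_is_monoid_morphism.

Lemma class_eq (f g : R) : class I f = class I g -> f - g \in I.
Proof. by move=> fgE; rewrite Quotient.idealrBE; apply/eqP. Qed.

End Class.

Lemma mcoeff_tensor (K : fieldType) (d : nat) (I : idealr {mpoly K[d]})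
    (P : {mpoly K[d]}) (f : {mpoly K[d]}) (m : 'X_{1..d}) :
  (tensor P (class I f))@_m = class I (P@_m *: f).
Proof.
rewrite /tensor mulrC mcoeffCM.
(* Writing the coefficient map as a composite exhibits it as a ring morphism. *)
rewrite (mcoeff_map_mpoly (class I \o @mpolyC d K)) /=.
by rewrite -rmorphM /= mulrC mul_mpolyC.
Qed.

Lemma tensor_var (K : fieldType) (d : nat) (I : idealr {mpoly K[d]})
    (j : 'I_d) (u : {ideal_quot I}) :
  tensor 'X_j u = u *: 'X_j.
Proof.
rewrite /tensor (map_mpolyX (class I \o @mpolyC d K)).
by rewrite mulrC mul_mpolyC.
Qed.

Theorem proposition6p11
  (K : fieldType) (d k N : nat)
  (s : {fset 'X_{1..d}}) (a : 'X_{1..d} -> K)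
  (k_gt0 : (0 < k)%N) (N_gt0 : (0 < N)%N)
  (s_neq0 : s != fset0)
  (s_deg : forall i, i \in s -> mdeg i = N)
  (s_le : forall i, i \in s -> forall j, (i j <= k - 1)%N)
  (a_neq0 : forall i, i \in s -> a i != 0)
  (mu : 'X_{1..d}) (mu_s : mu \in s)
  (mu_max : forall i, i \in s -> i != mu -> lex_lt i mu)
  (P : {mpoly K[d]}) :
  let p : {mpoly K[d]} := mpoly_of s a in
  let Delta : nat := (d * (k - 1) - N)%N in
  let I : idealr {mpoly K[d]} :=
    colon_ideal (p := p) (mpoly_of_notin k_gt0 s_neq0 s_le a_neq0) in
  (\sum_(j < d) tensor 'X_j (class I 'X_j)) ^+ Delta
    = tensor P (class I 'X_[codeg k mu]) ->
  exists2 c : K, c != 0 &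
    P = c *: \sum_(i <- s)
               ((multinomial Delta (codeg k i))%:R * a i) *: 'X_[codeg k i].
Proof.
(* The scalar is forced by the top coefficient of ['X_[codeg k mu] * p], which is [a mu]. *)
move=> p Delta I PE; exists (a mu)^-1; first by rewrite invr_neq0 ?a_neq0.
apply/mpolyP => m; have := congr1 (mcoeff m) PE.
rewrite (eq_bigr (fun j => class I 'X_j *: 'X_j)) => [|j _]; last first.
  exact: tensor_var.
rewrite mcoeff_linear_form_exp mcoeff_tensor.
set r := (if _ then _ else _).
(* Both coefficients of t^m are now classes of polynomials over [K], so their equality becomes a
   membership in [I]. *)
have -> : r%:R * (\prod_(j < d) class I 'X_j ^+ m j)
    = class I (r%:R *: 'X_[m]).
  rewrite scaler_nat rmorphMn /= mulr_natl mpolyXE_id rmorph_prod /=.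
  by congr (_ *+ r); apply: eq_bigr => j _; rewrite rmorphXn.
move=> /class_eq coef_I.
(* Membership in the colon ideal unfolds by conversion. *)
have coef_J : (r%:R *: 'X_[m] - P@_m *: 'X_[codeg k mu]) * p
    \in ideal_gen (power_vars K (d := d) k) by exact: coef_I.
have top_lt (j : 'I_d) : (codeg k 0 j < k)%N.
  by rewrite !mnmE subn0 subn1 prednK.
have := mcoeff_ideal_gen_power_vars coef_J top_lt.
rewrite mulrBl -!scalerAl mcoeffB !mcoeffZ ![_ * p]mulrC.
(* Splitting the top exponent as [mu + codeg k mu] reduces the second coefficient to that of [p] at
   [mu]. *)
rewrite mcoeff_mpoly_ofMX // -(codegK (s_le mu mu_s)) addmC mcoeffMX.
rewrite mcoeff_mpoly_of // => /eqP; rewrite subr_eq0 => /eqP sumE.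
rewrite -[LHS](mulfK (a_neq0 _ mu_s)) -sumE mulrC; congr (_ * _).
rewrite raddf_sum mulr_sumr; apply: eq_big_seq => i i_s /=.
rewrite mcoeffZ mcoeffX mulrA /r.
(* Only an [i] with [codeg k i = m] contributes; then [m] has degree [Delta], so [r] is the
   multinomial coefficient and not the default 0. *)
case: (codeg k i =P m) => [<-|_]; last by rewrite !mulr0.
by rewrite mdeg_codeg ?s_deg ?eqxx //; exact: (s_le i i_s).
Qed.
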